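(* Fix $n\ge1$ and $\boldsymbol{\alpha},\boldsymbol{\beta}\in\mathcal{X}_n$. As $r\to\infty$, $$\mathcal{Z}_{n\text{-}\mathrm{cro}}(r;\boldsymbol{\alpha},\boldsymbol{\beta})=\sqrt{2}^{\,n(n-1)}\,\frac{\mathcal{Z}_{n\text{-}\mathrm{rad}}(\boldsymbol{\alpha})\mathcal{Z}_{n\text{-}\mathrm{rad}}(\boldsymbol{\beta})}{n\sqrt{\pi/2}}\exp\Big(\frac{n(2-n)r}{8}+\frac{\log r}{2}+O(1)\big(e^{-r}+e^{-2r/n^2}\big)\Big);$$ moreover, when $n=2N$ is even, $$\sum_{m=1}^N\mathcal{Z}_{n\text{-}\mathrm{cro}}(r;\boldsymbol{\alpha},\beta_{2m+1},\ldots,\beta_{2m+n})=\sqrt{2}^{\,n(n-1)}\,\frac{\mathcal{Z}_{n\text{-}\mathrm{rad}}(\boldsymbol{\alpha})\mathcal{Z}_{n\text{-}\mathrm{rad}}(\boldsymbol{\beta})}{\sqrt{2\pi}}\exp\Big(\frac{n(2-n)r}{8}+\frac{\log r}{2}+O(1)\big(e^{-r}+e^{-2r/n^2}\big)\Big).$$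
   Context: $\mathcal{X}_n=\{\theta_1<\cdots<\theta_n<\theta_1+2\pi\}\subset\mathbb{R}^n$; convention $\beta_{n+j}=\beta_j+2\pi$. $\mathcal{Z}_{n\text{-}\mathrm{rad}}(\boldsymbol\theta)=\prod_{1\le i<j\le n}|e^{i\theta_i}-e^{i\theta_j}|^{1/2}$ for $\boldsymbol\theta\in\mathcal{X}_n$. $\Theta_1(r;z)=2e^{-r/4}\sin(z/2)\prod_{m\ge1}(1-e^{-2mr})(1-e^{-2mr}e^{iz})(1-e^{-2mr}e^{-iz})$, $\Theta_3(r;z)=\prod_{m\ge1}(1-e^{-2mr})(1-e^{-(2m-1)r}e^{iz})(1-e^{-(2m-1)r}e^{-iz})$. For $\ell\in\mathbb{Z}$, $$\mathcal{Z}_{n\text{-}\mathrm{cro}}^{(\ell)}(r;\boldsymbol{\alpha},\boldsymbol{\beta})=\exp\Big(\frac{nr}{8}-\frac1{8r}\Big(\sum_{j=1}^n(\alpha_j-\beta_j)-2n\pi\ell\Big)^2\Big)\prod_{m\ge1}(1-e^{-2mr})^{\frac{3n}{2}}\prod_{j=1}^n|\Theta_3(r;\beta_j-\alpha_j)|^{-\frac12}\prod_{1\le i<k\le n}\left(\frac{|\Theta_1(r;\alpha_k-\alpha_i)\Theta_1(r;\beta_k-\beta_i)|}{|\Theta_3(r;\beta_k-\alpha_i)\Theta_3(r;\beta_i-\alpha_k)|}\right)^{\frac12},$$ and $\mathcal{Z}_{n\text{-}\mathrm{cro}}=\sum_{\ell\in\mathbb{Z}}\mathcal{Z}_{n\t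ext{-}\mathrm{cro}}^{(\ell)}$.
   Formalization: The factor √2^{n(n-1)} is removed from both displays: with Z_rad = ∏|e^{iθ_i}−e^{iθ_j}|^{1/2} the ratio Z_cro to the remaining main term tends to 1, so the printed formulas fail for every n ≥ 2. *)

(* Defs.v *)
From HB Require Import structures.
From mathcomp Require Import all_boot all_order all_algebra.
From mathcomp Require Import all_classical all_reals all_analysis.
From mathcomp Require Import complex ring.

Set Implicit Arguments.
Unset Strict Implicit.
Unset Printing Implicit Defensive.

Import Order.TTheory GRing.Theory Num.Theory.
Import numFieldNormedType.Exports.
Import ComplexField.Normc.

Local Open Scope classical_set_scope.
Local Open Scope ring_scope.
Local Open Scope complex_scope.

(* Indices are 0-based: [theta i] stands for theta_(i+1). *)

(* The last conjunct, taken at the last index j and the first index i, is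
   theta_n < theta_1 + 2 pi; its other instances follow from monotonicity. *)
Definition chamber (R : realType) (n : nat) (theta : 'I_n -> R) : Prop :=
  (forall i j : 'I_n, (i < j)%N -> theta i < theta j) /\
  (forall i j : 'I_n, theta j < theta i + 2 * pi).

(* The tuple (beta_(k+1), ..., beta_(k+n)) under the convention
   beta_(n+j) = beta_j + 2 pi. *)
Definition shift_angles (R : realType) (n : nat) (k : nat) (beta : 'I_n -> R) :
    'I_n -> R :=
  fun j =>
    beta (Ordinal (ltn_pmod (k + j) (leq_ltn_trans (leq0n j) (ltn_ord j))))
    + ((k + j) %/ n)%:R * (2 * pi).

Definition expi (R : realType) (t : R) : R[i] := cos t +i* sin t.

Definition infprod (R : realType) (u : nat -> R) : R :=
  limn (fun M : nat => \prod_(1 <= m < M.+1) u m).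

(* (1 - q e^(iz)) (1 - q e^(-iz)); this product is a real number (see
   [theta_factor_real]), so taking the real part loses nothing. *)
Definition theta_factor (R : realType) (q z : R) : R :=
  complex.Re ((1 - q%:C * expi z) * (1 - q%:C * expi (- z))).

Lemma theta_factorE (R : realType) (q z : R) :
  theta_factor q z = 1 - 2 * q * cos z + q ^+ 2.
Proof.
rewrite /theta_factor /expi cosN sinN; simpc => /=.
have -> : q ^+ 2 = q ^+ 2 * (cos z ^+ 2 + sin z ^+ 2) by rewrite cos2Dsin2 mulr1.
by ring.
Qed.

Lemma theta_factor_real (R : realType) (q z : R) :
  (1 - q%:C * expi z) * (1 - q%:C * expi (- z)) = (theta_factor q z)%:C.
Proof.
rewrite /theta_factor /expi cosN sinN; simpc => /=.
by apply/eqP; rewrite eq_complex /= eqxx /=; apply/eqP; ring.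
Qed.

Definition Theta1 (R : realType) (r z : R) : R :=
  2 * expR (- (r / 4)) * sin (z / 2) *
  infprod (fun m => (1 - expR (- (2 * m%:R * r))) *
                    theta_factor (expR (- (2 * m%:R * r))) z).

Definition Theta3 (R : realType) (r z : R) : R :=
  infprod (fun m => (1 - expR (- (2 * m%:R * r))) *
                    theta_factor (expR (- ((2 * m%:R - 1) * r))) z).

Definition Zrad (R : realType) (n : nat) (theta : 'I_n -> R) : R :=
  \prod_(i < n) \prod_(j < n | (i < j)%N)
    normc (expi (theta i) - expi (theta j)) `^ (1 / 2).

Definition Zcro_l (R : realType) (n : nat) (l : int) (r : R)
    (alpha beta : 'I_n -> R) : R :=
  expR (n%:R * r / 8 -
        1 / (8 * r) *
        (\sum_(j < n) (alpha j - beta j) - 2 * n%:R * pi * l%:~R) ^+ 2) *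
  infprod (fun m => (1 - expR (- (2 * m%:R * r))) `^ (3 * n%:R / 2)) *
  (\prod_(j < n) `|Theta3 r (beta j - alpha j)| `^ (- (1 / 2))) *
  \prod_(i < n) \prod_(k < n | (i < k)%N)
    (`|Theta1 r (alpha k - alpha i) * Theta1 r (beta k - beta i)| /
     `|Theta3 r (beta k - alpha i) * Theta3 r (beta i - alpha k)|) `^ (1 / 2).

(* The sum over all integers l has nonnegative terms; it is taken in [0, +oo],
   so that its finiteness is part of any equation with a real number. *)
Definition Zcro (R : realType) (n : nat) (r : R) (alpha beta : 'I_n -> R) :
    \bar R :=
  (\esum_(l in [set: int]) (Zcro_l l r alpha beta)%:E)%E.

(* Since |e^(ia) - e^(ib)| = 2 |sin ((b - a) / 2)|, the factor
   sqrt 2 ^ (n (n - 1)) occurs when two copies of [Zrad] are rewritten with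
   sines, and must not be written a second time in front of [Zrad]. *)
Lemma normc_expiB (R : realType) (a b : R) :
  normc (expi a - expi b) = 2 * `|sin ((b - a) / 2)|.
Proof.
have -> : expi a = expi ((a + b) / 2 - (b - a) / 2) by congr expi; field.
have -> : expi b = expi ((a + b) / 2 + (b - a) / 2) by congr expi; field.
move: ((a + b) / 2) ((b - a) / 2) => u v; rewrite /expi; simpc => /=.
rewrite cosB sinB cosD sinD.
have -> : (cos u * cos v + sin u * sin v - (cos u * cos v - sin u * sin v)) ^+ 2
    + (sin u * cos v - cos u * sin v - (sin u * cos v + cos u * sin v)) ^+ 2
    = (cos u ^+ 2 + sin u ^+ 2) * (2 * sin v) ^+ 2 by ring.
by rewrite cos2Dsin2 mul1r sqrtr_sqr normrM normr_nat.
Qed.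

Lemma Zrad_sin (R : realType) (n : nat) (alpha beta : 'I_n -> R) :
  Zrad alpha * Zrad beta =
  Num.sqrt 2 ^+ (n * (n - 1)) *
  ((\prod_(i < n) \prod_(j < n | (i < j)%N)
      `|sin ((alpha j - alpha i) / 2)| `^ (1 / 2)) *
   (\prod_(i < n) \prod_(j < n | (i < j)%N)
      `|sin ((beta j - beta i) / 2)| `^ (1 / 2))).
Proof.
have Zrad_sin1 (theta : 'I_n -> R) : Zrad theta =
    Num.sqrt 2 ^+ 'C(n, 2) * \prod_(i < n) \prod_(j < n | (i < j)%N)
      `|sin ((theta j - theta i) / 2)| `^ (1 / 2).
  have -> : 'C(n, 2) = (\sum_(i < n) \sum_(j < n | (i < j)%N) 1)%N.
    rewrite -bin2_sum big_mkord [RHS](exchange_big_dep predT) //=.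
    apply: eq_bigr => j _; rewrite -{1}(card_ord j) -sum1_card.
    by rewrite (big_ord_widen_cond n xpredT (fun=> 1%N) (ltnW (ltn_ord j))).
  rewrite expr_sum -big_split /=; apply: eq_bigr => i _.
  rewrite expr_sum -big_split /=; apply: eq_bigr => j _.
  have /= -> := normc_expiB (theta i) (theta j).
  by rewrite powRM // expr1 div1r powR12_sqrt.
rewrite !Zrad_sin1 mulrACA -exprD addnn; congr (_ ^+ _ * _).
by rewrite -mul2n -mul_bin_diag bin1 subn1.
Qed.

(* Main.v *)
Require Import Defs.
From HB Require Import structures.
From mathcomp Require Import all_boot all_order all_algebra.
From mathcomp Require Import all_classical all_reals all_analysis.
From mathcomp Require Import complex ring lra zify.

(** The sum over [l] only enters through the Gaussian factor of [Zcro_l], so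
    the partition function is a prefactor times a sum of Gaussians over the
    integers.

    Prefactor. Write [q = expR (- r)]. Each theta function is an infinite product
    whose [m]-th factor differs from 1 by O([q ^+ m]), uniformly in the angle, so
    that [Theta3] is exp(O(q)) and [Theta1 r z] is
    [2 * expR (- (r / 4)) * sin (z / 2)] times exp(O(q)). The sines build
    [Zrad alpha * Zrad beta] and the powers of [expR r] add up to
    [n * (2 - n) * r / 8]. Errors are kept in the multiplicative form
    [exp_close], which is stable under products, powers and infinite products
    ([exp_closeM], [exp_close_powR], [exp_close_infprod]); the outcome is
    [Zcro_l_factor].

    Gaussian sum. What remains is the sum of [expR (- (pi ^+ 2 * (l - a) ^+ 2 / c))]
    over the integers [l], with [c = 2 * r / n ^+ 2]. By Poisson summation it
    equals [sqrt (c / pi) * (1 + O(expR (- c)))]. This is [gauss_sum_asymp], and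
    it is obtained from a finite identity, following Polya: the average of
    [cos ^ (2 * m)] over [L] equispaced points retains only the binomial
    coefficients of index congruent to [m] modulo [L]
    ([cosX_equispaced_sum]). The central one gives the main term, and the others
    are dominated by a geometric series of ratio close to
    [expR (- (L ^+ 2 / m))]. When [L] tends to infinity with [L ^+ 2 / m] tending
    to [c], the powers of the cosine tend to the Gaussian terms, and Wallis'
    product ([return_prob_sqr_le], [return_prob_sqr_ge]) gives the central
    binomial coefficient.

    Both estimates are uniform in the angles ([Zcro_asymp]). Since [Zrad] does
    not change under rotation of the labels ([Zrad_shift]), the [N] terms of the
    second claim have the same main term, their sum is [N] times it, and
    [N / (2 * N * sqrt (pi / 2))] is [1 / sqrt (2 * pi)]. *)

Set Implicit Arguments.
Unset Strict Implicit.
Unset Printing Implicit Defensive.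

Import Order.TTheory GRing.Theory Num.Theory.
Import numFieldNormedType.Exports.
Import ComplexField.Normc.

Local Open Scope classical_set_scope.
Local Open Scope ring_scope.

(** * Elementary calculus *)

Lemma is_derive_ge0_le (R : realType) (f df : R -> R) (a b : R) :
  (forall x : R, is_derive x 1 f (df x)) ->
  (forall x, a <= x <= b -> 0 <= df x) -> a <= b -> f a <= f b.
Proof.
move=> fdf df_ge0 ab.
have fcont : {within `[a, b], continuous f}.
  apply: continuous_subspaceT => x; apply: differentiable_continuous.
  by apply/derivable1_diffP; case: (fdf x).
have [c cab fab] := MVT_segment ab (fun x _ => fdf x) fcont.
by rewrite -subr_ge0 fab mulr_ge0 ?subr_ge0// df_ge0// (itvP cab).
Qed.

Lemma sin_le_id (R : realType) (x : R) : 0 <= x -> sin x <= x.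
Proof.
move=> x0; rewrite -subr_ge0.
have := @is_derive_ge0_le R (fun y => y - sin y) (fun y => 1 - cos y) 0 x.
by rewrite sin0 subrr; apply => // y _; rewrite subr_ge0 cos_le1.
Qed.

Lemma cos_ge_quad (R : realType) (x : R) : 1 - x ^+ 2 / 2 <= cos x.
Proof.
wlog x0 : x / 0 <= x.
  move=> h; have [/h//|x0] := leP 0 x.
  by rewrite -cosN -sqrrN h// oppr_ge0 ltW.
have := @is_derive_ge0_le R (fun y => cos y + y ^+ 2 / 2) (fun y => y - sin y) 0 x.
rewrite cos0 expr0n mul0r addr0 lerBlDr; apply => // [y|y /andP[y0 _]].
- by apply: is_derive_eq; rewrite /GRing.scale /=; field.
- by rewrite subr_ge0 sin_le_id.
Qed.

(** The ratio of the two sides is nonincreasing because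
    [y * cos y <= sin y] on the first quadrant. *)
Lemma cos_le_gauss (R : realType) (x : R) :
  `|x| <= pi / 2 -> cos x <= expR (- (x ^+ 2 / 2)).
Proof.
wlog x0 : x / 0 <= x.
  move=> h; have [/h//|x0] := leP 0 x.
  by rewrite -cosN -normrN -(sqrrN x); apply: h; rewrite oppr_ge0 ltW.
rewrite ger0_norm// => xpi.
have ycos_le (y : R) : 0 <= y <= x -> y * cos y <= sin y.
  move=> /andP[y0 yx].
  have := @is_derive_ge0_le R (fun z => sin z - z * cos z) (fun z => z * sin z) 0 y.
  rewrite sin0 mul0r subr0 subr_ge0; apply => // [z|z /andP[z0 zy]].
  - by apply: is_derive_eq; rewrite /GRing.scale /=; ring.
  - rewrite mulr_ge0// sin_ge0_pi// z0 (le_trans zy)// (le_trans yx)//.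
    by rewrite (le_trans xpi)// ler_pdivrMr// ler_peMr ?pi_ge0// ler1n.
have := @is_derive_ge0_le R (fun y => - (expR (y ^+ 2 / 2) * cos y))
  (fun y => expR (y ^+ 2 / 2) * (sin y - y * cos y)) 0 x.
rewrite expr0n mul0r expR0 mul1r cos0 lerN2 expRN -[(expR _)^-1]mul1r.
rewrite ler_pdivlMr ?expR_gt0// mulrC; apply => // [y|y yx].
- have gy : is_derive y 1 (fun y : R => y ^+ 2 / 2) y.
    by apply: is_derive_eq; rewrite /GRing.scale /=; field.
  have ey : is_derive y 1 (fun y : R => expR (y ^+ 2 / 2)) (expR (y ^+ 2 / 2) * y).
    exact: (@is_derive1_comp _ expR (fun y : R => y ^+ 2 / 2)).
  by apply: is_derive_eq; rewrite /GRing.scale /=; ring.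
- by rewrite mulr_ge0 ?expR_ge0// subr_ge0 ycos_le.
Qed.

(** * The central binomial coefficient *)

(** The antiderivative of [cos ^ n] vanishing at 0, given by the reduction
    formula for powers of the cosine. *)
Fixpoint cospow_prim (R : realType) (n : nat) (x : R) : R :=
  match n with
  | 0%N => x
  | 1%N => sin x
  | (k.+1 as m).+1 =>
      (m%:R * cospow_prim k x + cos x ^+ m * sin x) / m.+1%:R
  end.

Lemma is_derive_cospow_prim (R : realType) (n : nat) (x : R) :
  is_derive x 1 (cospow_prim n) (cos x ^+ n).
Proof.
elim/ltn_ind: n x => -[|[|n]] IH x.
- rewrite expr0; exact: is_derive_id.
- rewrite expr1; exact: is_derive_sin.
- have IHx := IH n (leqW (leqnn _)) x.
  rewrite -[cospow_prim n.+2]/(fun y =>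
    (n.+1%:R * cospow_prim n y + cos y ^+ n.+1 * sin y) / n.+2%:R).
  move: (cospow_prim n) IHx => F IHx.
  have cX : is_derive x 1 (fun y : R => cos y ^+ n.+1)
      (n.+1%:R * cos x ^+ n * - sin x).
    have -> : (fun y : R => cos y ^+ n.+1) = (@cos R) ^+ n.+1.
      by apply/funext => y; rewrite fctE.
    exact: is_deriveX.
  apply: is_derive_eq; rewrite /GRing.scale /=.
  have -> : sin x * (n.+1%:R * cos x ^+ n * - sin x) =
     - (n.+1%:R * cos x ^+ n * sin x ^+ 2) by ring.
  rewrite sin2cos2 !exprS -(natr1 n.+1); field.
  by rewrite nat1r natr1 pnatr_eq0.
Qed.

(** The integral of [cos ^ n] from 0 to [pi / 2]. *)
Definition wallis_int (R : realType) (n : nat) : R := cospow_prim n (pi / 2).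

Lemma wallis_intSS (R : realType) (n : nat) :
  wallis_int R n.+2 = n.+1%:R / n.+2%:R * wallis_int R n.
Proof.
by rewrite /wallis_int /= cos_pihalf expr0n /= mul0r addr0 mulrAC.
Qed.

Lemma wallis_int_ge0 (R : realType) (n : nat) : 0 <= wallis_int R n.
Proof.
elim/ltn_ind: n => -[|[|n]] IH.
- by rewrite /wallis_int /= divr_ge0// pi_ge0.
- by rewrite /wallis_int /= sin_pihalf.
- by rewrite wallis_intSS mulr_ge0// ?divr_ge0// IH// (leqW (leqnn _)).
Qed.

Lemma wallis_int_dec (R : realType) (n : nat) :
  wallis_int R n.+1 <= wallis_int R n.
Proof.
have prim0 k : cospow_prim k 0 = 0 :> R.
  elim/ltn_ind: k => -[//|[|k]] IH /=; first exact: sin0.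
  by rewrite IH ?(leqW (leqnn _))// sin0 !mulr0 addr0 mul0r.
rewrite -subr_ge0 /wallis_int.
have := @is_derive_ge0_le R (fun x => cospow_prim n x - cospow_prim n.+1 x)
  (fun x => cos x ^+ n - cos x ^+ n.+1) 0 (pi / 2).
rewrite !prim0 subrr; apply.
- move=> x; apply: is_deriveB; exact: is_derive_cospow_prim.
- move=> x /andP[x0 xpi]; have cx : 0 <= cos x.
    by rewrite cos_ge0_pihalf// xpi andbT (le_trans _ x0)// oppr_le0 divr_ge0 ?pi_ge0.
  by rewrite subr_ge0 exprS ler_piMl ?exprn_ge0// cos_le1.
- by rewrite divr_ge0 ?pi_ge0.
Qed.

Lemma wallis_int_prod (R : realType) (n : nat) :
  wallis_int R n * wallis_int R n.+1 = pi / 2 / n.+1%:R.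
Proof.
elim: n => [|n IH]; first by rewrite /wallis_int /= sin_pihalf mulr1 divr1.
rewrite wallis_intSS mulrCA (mulrC (wallis_int _ _)) IH.
field.
by have := ler0n R n => ?; rewrite !lt0r_neq0 //; lra.
Qed.

(** The probability that a fair walk is at its origin at time [2 * m]. *)
Definition return_prob (R : realType) (m : nat) : R :=
  'C(2 * m, m)%:R / 4 ^+ m.

Lemma return_prob_gt0 (R : realType) (m : nat) : 0 < return_prob R m.
Proof. by rewrite divr_gt0 ?exprn_gt0// ltr0n bin_gt0 leq_pmull. Qed.

Lemma wallis_int_even (R : realType) (m : nat) :
  wallis_int R (2 * m) = pi / 2 * return_prob R m.
Proof.
elim: m => [|m IH].
  by rewrite /wallis_int /return_prob muln0 bin0 expr0 divr1 mulr1.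
have binS : 'C(2 * m.+1, m.+1)%:R * m.+1%:R
    = 'C(2 * m, m)%:R * 2 * (2 * m).+1%:R :> R.
  rewrite -!natrM; congr _%:R.
  have D := mul_bin_diag (2 * m).+2 m; have E := mul_bin_down (2 * m).+1 m.
  have e1 : ((2 * m).+1 - m = m.+1)%N by lia.
  have e2 : (2 * m.+1 = (2 * m).+2)%N by lia.
  rewrite /= e1 in D E; rewrite e2 mulnC -D.
  by move: 'C(_, _) 'C(_, _) E => a b; nia.
rewrite mulnS wallis_intSS IH /return_prob.
have -> : 'C(2 * m.+1, m.+1)%:R
    = 'C(2 * m, m)%:R * 2 * (2 * m).+1%:R / m.+1%:R :> R.
  by rewrite -binS mulfK// pnatr_eq0.
have -> : (2 * m).+2%:R = 2 * m.+1%:R :> R by rewrite -natrM mulnS.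
by rewrite exprS; field; rewrite expf_neq0//= ?pnatr_eq0//.
Qed.

(** Wallis' product, in the form of two-sided bounds: the integrals of two
    consecutive powers of the cosine have a known product. *)
Lemma return_prob_sqr_le (R : realType) (m : nat) : (0 < m)%N ->
  return_prob R m ^+ 2 <= (pi * m%:R)^-1.
Proof.
case: m => // m _.
have pi_gt0' := pi_gt0 R.
have -> : return_prob R m.+1 ^+ 2 = (2 / pi) ^+ 2 * wallis_int R (2 * m.+1) ^+ 2.
  rewrite wallis_int_even; move: (@pi R) pi_gt0' => p p0; field.
  by rewrite lt0r_neq0.
have -> : (pi * m.+1%:R)^-1
    = (2 / pi) ^+ 2 * (wallis_int R (2 * m).+1 * wallis_int R (2 * m).+2).
  have e : (2 * m).+2%:R = 2 * m.+1%:R :> R by rewrite -natrM mulnS.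
  rewrite wallis_int_prod e -natr1.
  move: (@pi R) pi_gt0' => p p0; field.
  by have := ler0n R m => ?; rewrite !lt0r_neq0 //; lra.
rewrite ler_wpM2l ?sqr_ge0// mulnS expr2 ler_wpM2r ?wallis_int_ge0//.
exact: wallis_int_dec.
Qed.

Lemma return_prob_sqr_ge (R : realType) (m : nat) :
  (pi * (m%:R + 1 / 2))^-1 <= return_prob R m ^+ 2.
Proof.
have pi_gt0' := pi_gt0 R.
have -> : return_prob R m ^+ 2 = (2 / pi) ^+ 2 * wallis_int R (2 * m) ^+ 2.
  rewrite wallis_int_even; move: (@pi R) pi_gt0' => p p0; field.
  by rewrite lt0r_neq0.
have -> : (pi * (m%:R + 1 / 2))^-1
    = (2 / pi) ^+ 2 * (wallis_int R (2 * m) * wallis_int R (2 * m).+1).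
  have e : (2 * m).+1%:R = 2 * m%:R + 1 :> R by rewrite -natr1 natrM.
  rewrite wallis_int_prod e.
  move: (@pi R) pi_gt0' => p p0; field.
  by have := ler0n R m => ?; rewrite !lt0r_neq0 //; lra.
by rewrite ler_wpM2l ?sqr_ge0// expr2 ler_wpM2l ?wallis_int_ge0 ?wallis_int_dec.
Qed.

(** * Equispaced sums of even powers of the cosine *)

Lemma cos_prod_sum (R : realType) (x y : R) :
  2 * cos x * cos y = cos (y + x) + cos (y - x).
Proof. by rewrite cosD cosB; ring. Qed.

(** The real part of the binomial theorem for [e^(ix) + e^(-ix)]. *)
Lemma cosX_sum (R : realType) (n : nat) (x : R) :
  (2 * cos x) ^+ n = \sum_(j < n.+1) 'C(n, j)%:R * cos ((n%:R - 2 * j%:R) * x).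
Proof.
elim: n => [|n IH].
  by rewrite big_ord1 bin0 expr0 mulr0 subr0 mul0r cos0 mulr1.
pose c j := cos ((n.+1%:R - 2 * j%:R) * x).
rewrite exprS IH big_distrr /=.
have -> : \sum_(j < n.+1) 2 * cos x * ('C(n, j)%:R * cos ((n%:R - 2 * j%:R) * x))
    = \sum_(j < n.+1) 'C(n, j)%:R * c j + \sum_(j < n.+1) 'C(n, j)%:R * c j.+1.
  rewrite -big_split /=; apply: eq_bigr => j _.
  rewrite mulrCA cos_prod_sum mulrDr; congr (_ * cos _ + _ * cos _);
    by rewrite -!natr1; ring.
rewrite [RHS]big_ord_recl /= bin0.
under [X in _ = _ + X]eq_bigr => j _ do
  rewrite /bump leq0n add1n binS natrD mulrDl.
rewrite big_split /= addrA; congr (_ + _).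
by rewrite big_ord_recl [in RHS]big_ord_recr /= bin0 bin_small// mul0r addr0.
Qed.

(** The two terms of opposite frequencies [2 * s] and [- 2 * s] are equal, which
    leaves a sum over positive frequencies. *)
Lemma cosX_even (R : realType) (m : nat) (x : R) :
  (2 * cos x) ^+ (2 * m) = 'C(2 * m, m)%:R +
    2 * \sum_(0 <= s < m) 'C(2 * m, m + s.+1)%:R * cos (2 * s.+1%:R * x).
Proof.
rewrite cosX_sum.
pose f j : R := 'C(2 * m, j)%:R * cos (((2 * m)%:R - 2 * j%:R) * x).
rewrite -(big_mkord xpredT f) (@big_cat_nat _ _ _ m)//=; last by lia.
have -> : \sum_(m <= i < (2 * m).+1) f i = f m + \sum_(0 <= s < m) f (m + s.+1)%N.
  rewrite -{1}[m]add0n big_addn (_ : (2 * m).+1 - m = m.+1)%N; last by lia.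
  rewrite big_nat_recl// add0n; congr (_ + _).
  by apply: eq_bigr => s _; rewrite addnC.
have -> : \sum_(0 <= i < m) f i = \sum_(0 <= s < m) f (m + s.+1)%N.
  rewrite big_nat_rev /=; apply: eq_big_nat => s /andP[_ sm].
  rewrite add0n /f -bin_sub; last by lia.
  rewrite (_ : 2 * m - (m - s.+1) = m + s.+1)%N; last by lia.
  rewrite -cosN; congr (_ * cos _).
  by rewrite natrB// natrD natrM; ring.
have -> : f m = 'C(2 * m, m)%:R by rewrite /f natrM subrr mul0r cos0 mulr1.
rewrite addrCA mulr_natl mulr2n; congr (_ + (_ + _));
  apply: eq_bigr => s _; rewrite /f -cosN; congr (_ * cos _);
  by rewrite natrD natrM; ring.
Qed.

(** Multiplication by [sin h], for [h] half of the step, makes the sum telescope;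
    [sin h] is nonzero because [L] does not divide [D]. *)
Lemma sum_cos_roots (R : realType) (L D : nat) (y : R) :
  (0 < L)%N -> ~~ (L %| D)%N ->
  \sum_(k < L) cos (y + k%:R * (2 * pi * D%:R / L%:R)) = 0.
Proof.
move=> L0 LD; set h : R := pi * D%:R / L%:R.
have Lneq0 : L%:R != 0 :> R by rewrite pnatr_eq0 -lt0n.
have sinh0 : sin h != 0.
  have r0 : (0 < D %% L)%N by rewrite lt0n.
  have -> : h = pi * (D %% L)%:R / L%:R + pi *+ (D %/ L).
    rewrite /h {1}(divn_eq D L) natrD natrM -mulr_natr; by field.
  rewrite (alternatingn (@sinDpi R)) mulf_neq0 ?signr_eq0//.
  rewrite gt_eqF// sin_gt0_pi// -mulrA !mulr_gt0 ?pi_gt0 ?invr_gt0 ?ltr0n//=.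
  by rewrite gtr_pMr ?pi_gt0// ltr_pdivrMr ?ltr0n// mul1r ltr_nat ltn_mod.
apply: (mulfI sinh0); rewrite mulr0; apply: (@mulfI _ 2) => //.
rewrite mulr0 mulrA big_distrr /=.
pose g (k : nat) := sin (y - h + k%:R * (2 * h)).
have -> : \sum_(i < L) 2 * sin h * cos (y + i%:R * (2 * pi * D%:R / L%:R))
    = \sum_(0 <= i < L) (g i.+1 - g i).
  rewrite big_mkord; apply: eq_bigr => k _; rewrite /g -(natr1 k).
  have -> : 2 * pi * D%:R / L%:R = 2 * h by rewrite /h; ring.
  have -> : y - h + (k%:R + 1) * (2 * h) = y + k%:R * (2 * h) + h by ring.
  have -> : y - h + k%:R * (2 * h) = y + k%:R * (2 * h) - h by ring.
  by rewrite sinD sinB; ring.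
rewrite telescope_sumr// /g mul0r addr0.
have -> : L%:R * (2 * h) = (pi *+ 2) *+ D.
  by rewrite -mulrnA -[RHS]mulr_natr natrM /h; field.
by rewrite (periodicn (@sinD2pi R)) subrr.
Qed.

(** After clearing factorials, the bound compares two falling factorials
    factor by factor. *)
Lemma bin_offcenter_leq (m s : nat) : (s <= m)%N ->
  ('C(2 * m, m + s) * (m + s) ^ s <= 'C(2 * m, m) * m ^ s)%N.
Proof.
move=> sm.
have H1 : ('C(2 * m, m + s) * (m + s) ^_ s = 'C(2 * m, m) * m ^_ s)%N.
  have E1 := @bin_fact (2 * m) (m + s) ltac:(lia).
  have E0 := @bin_fact (2 * m) m ltac:(lia).
  rewrite (_ : 2 * m - (m + s) = m - s)%N in E1; last by lia.
  rewrite (_ : 2 * m - m = m)%N in E0; last by lia.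
  have F1 := @ffact_fact (m + s) s (leq_addl _ _); rewrite addnK in F1.
  have F2 := @ffact_fact m s sm.
  apply/eqP; rewrite -(eqn_pmul2r (fact_gt0 m)) -(eqn_pmul2r (fact_gt0 (m - s))).
  rewrite -!mulnA [in X in X == _](mulnA ((m + s) ^_ s)) F1 E1.
  by rewrite [(m ^_ s * _)%N]mulnCA F2 E0.
have H2 : (m ^_ s * (m + s) ^ s <= (m + s) ^_ s * m ^ s)%N.
  rewrite !ffact_prod -[X in (_ * _ ^ X <= _)%N](card_ord s).
  rewrite -[X in (_ <= _ * _ ^ X)%N](card_ord s) -!prod_nat_const -!big_split /=.
  apply: leq_prod => i _; have := ltn_ord i; nia.
have P : (0 < (m + s) ^_ s)%N by rewrite ffact_gt0 leq_addl.
rewrite -(leq_pmul2r P) mulnAC H1 -!mulnA leq_mul2l; apply/orP; right.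
by rewrite mulnC [X in (_ <= X)%N]mulnC mulnC.
Qed.

Lemma bin_offcenter_le (R : realType) (m s : nat) : (s <= m)%N ->
  'C(2 * m, m + s)%:R <=
    'C(2 * m, m)%:R * expR (- (s%:R ^+ 2 / (m + s)%:R)) :> R.
Proof.
case: s => [|s] sm; first by rewrite addn0 expr0n mul0r oppr0 expR0 mulr1.
have ms0 : 0 < (m + s.+1)%:R :> R by rewrite ltr0n addnS.
have -> : - (s.+1%:R ^+ 2 / (m + s.+1)%:R) =
    s.+1%:R * (- (s.+1%:R / (m + s.+1)%:R)) :> R by ring.
rewrite expRM_natl.
apply: (@le_trans _ _ ('C(2 * m, m)%:R * (m%:R / (m + s.+1)%:R) ^+ s.+1)).
  rewrite expr_div_n mulrA ler_pdivlMr ?exprn_gt0//.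
  by rewrite -!natrX -!natrM ler_nat bin_offcenter_leq.
apply: ler_wpM2l => //; apply: lerXn2r; rewrite ?nnegrE ?divr_ge0 ?expR_ge0//.
apply: le_trans (expR_ge1Dx _).
rewrite ler_pdivrMr// mulrDl mul1r mulNr mulfVK ?gt_eqF//.
by rewrite natrD addrK.
Qed.

Lemma sum_multiples (V : nmodType) (L m : nat) (h : nat -> V) : (0 < L)%N ->
  \sum_(0 <= s < m | (L %| s.+1)%N) h (s.+1 %/ L)%N =
  \sum_(0 <= k < m %/ L) h k.+1.
Proof.
move=> L0; elim: m => [|m IH]; first by rewrite div0n !big_nil.
rewrite big_mkcond big_nat_recr//= -big_mkcond IH /= divnS//.
case: (boolP (L %| m.+1)%N) => [d|_]; last by rewrite add0n addr0.
by rewrite add1n big_nat_recr.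
Qed.

Lemma geometric_sum_le (R : realFieldType) (N : nat) (p : R) : 0 <= p < 1 ->
  \sum_(0 <= k < N) p ^+ k.+1 <= p / (1 - p).
Proof.
move=> /andP[p0 p1]; have q0 : 0 < 1 - p by rewrite subr_gt0.
suff -> : \sum_(0 <= k < N) p ^+ k.+1 = p * (1 - p ^+ N) / (1 - p).
  rewrite ler_pM2r ?invr_gt0// ler_piMr// gerBl exprn_ge0//.
elim: N => [|N IH]; first by rewrite big_nil expr0 subrr mulr0 mul0r.
by rewrite big_nat_recr//= IH !exprS; field; rewrite gt_eqF.
Qed.

(** Averaging over a full period kills every frequency which is not a
    multiple of [L]; the remaining ones are dominated by a geometric series. *)
Lemma cosX_equispaced_sum (R : realType) (L m : nat) (a : R) :
  (0 < L)%N -> (0 < m)%N ->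
  let p := expR (- (L%:R ^+ 2 / (m%:R + L%:R))) in
  `|\sum_(k < L) cos (pi * (k%:R - a) / L%:R) ^+ (2 * m)
     - L%:R * return_prob R m| <=
  L%:R * return_prob R m * (2 * (p / (1 - p))).
Proof.
move=> L0 m0 /=; set p := expR _.
have LR0 : 0 < L%:R :> R by rewrite ltr0n.
have mR0 : 0 < m%:R :> R by rewrite ltr0n.
have p01 : 0 <= p < 1.
  by rewrite expR_ge0 expR_lt1 oppr_lt0 divr_gt0 ?exprn_gt0 ?addr_gt0.
pose T (s : nat) := \sum_(k < L) cos (2 * s%:R * (pi * (k%:R - a) / L%:R)).
have T0 s : ~~ (L %| s)%N -> T s = 0.
  move=> Ls; rewrite -[RHS](@sum_cos_roots R L s (- (2 * s%:R * pi * a / L%:R)) L0 Ls).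
  by apply: eq_bigr => k _; congr cos; field; rewrite gt_eqF.
have T1 s : `|T s| <= L%:R.
  apply: le_trans (ler_norm_sum _ _ _) _.
  apply: le_trans (ler_sum _ (fun i _ => cos_max _)) _.
  by rewrite sumr_const card_ord.
have four : (4 : R) ^+ m = 2 ^+ (2 * m) by rewrite exprM expr2 -natrM.
have -> : \sum_(k < L) cos (pi * (k%:R - a) / L%:R) ^+ (2 * m) =
    L%:R * return_prob R m +
    2 / 4 ^+ m * \sum_(0 <= s < m) 'C(2 * m, m + s.+1)%:R * T s.+1.
  transitivity (\sum_(k < L) (return_prob R m + 2 / 4 ^+ m *
      \sum_(0 <= s < m) 'C(2 * m, m + s.+1)%:R *
        cos (2 * s.+1%:R * (pi * (k%:R - a) / L%:R)))).
    apply: eq_bigr => k _; have := cosX_even m (pi * (k%:R - a) / L%:R).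
    rewrite exprMn -four => E.
    apply: (@mulfI _ (4 ^+ m)); first by rewrite expf_neq0.
    rewrite E /return_prob; field; by rewrite expf_neq0.
  rewrite big_split /= sumr_const card_ord -[_ *+ L]mulr_natl; congr (_ + _).
  rewrite -mulr_sumr exchange_big /=; congr (_ * _).
  by apply: eq_bigr => s _; rewrite mulr_sumr.
rewrite addrAC subrr add0r.
have -> : L%:R * return_prob R m * (2 * (p / (1 - p)))
  = 2 / 4 ^+ m * ('C(2 * m, m)%:R * L%:R * (p / (1 - p))).
  rewrite /return_prob; ring.
rewrite normrM ger0_norm ?divr_ge0 ?exprn_ge0// ler_wpM2l ?divr_ge0 ?exprn_ge0//.
apply: le_trans (ler_norm_sum _ _ _) _.
apply: (@le_trans _ _ (\sum_(0 <= s < m | (L %| s.+1)%N)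
    'C(2 * m, m)%:R * L%:R * p ^+ (s.+1 %/ L))).
  rewrite [leRHS]big_mkcond /=; apply: ler_sum_nat => s /andP[_ sm].
  case: ifPn => [Ls|/T0 ->]; last by rewrite mulr0 normr0.
  rewrite normrM ger0_norm//; set k := (s.+1 %/ L)%N.
  have sE : s.+1 = (k * L)%N by rewrite divnK.
  have k0 : (0 < k)%N by move: sE; case: k.
  rewrite mulrAC ler_pM// (le_trans (@bin_offcenter_le R m s.+1 sm))//.
  rewrite ler_wpM2l// -expRM_natl ler_expR mulrN lerN2 sE natrD natrM.
  have kR : 1 <= k%:R :> R by rewrite ler1n.
  have -> : k%:R * (L%:R ^+ 2 / (m%:R + L%:R)) =
    k%:R * L%:R ^+ 2 / (m%:R + L%:R) :> R by rewrite mulrA.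
  have kL0 : 0 < m%:R + k%:R * L%:R :> R.
    by rewrite addr_gt0// mulr_gt0// (lt_le_trans _ kR).
  rewrite ler_pdivrMr ?addr_gt0// mulrAC ler_pdivlMr//.
  have -> : (k%:R * L%:R) ^+ 2 * (m%:R + L%:R) =
    (k%:R * L%:R ^+ 2) * (k%:R * m%:R + k%:R * L%:R) :> R by ring.
  rewrite ler_wpM2l ?mulr_ge0 ?exprn_ge0//.
  by rewrite lerD2r ler_peMl// ltW.
rewrite (sum_multiples m (fun k => 'C(2 * m, m)%:R * L%:R * p ^+ k) L0).
by rewrite -mulr_sumr ler_wpM2l ?mulr_ge0// geometric_sum_le.
Qed.

(** * Unordered sums and blocks of integers *)

Lemma esum_le_seq (R : realType) (T : choiceType) (f : T -> R) (M : R) :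
  (forall s : seq T, uniq s -> \sum_(i <- s) f i <= M) ->
  (\esum_(i in [set: T]) (f i)%:E <= M%:E)%E.
Proof.
move=> fM; apply: ge_ereal_sup => _ [A [Afin _] <-].
by rewrite fsbig_finite//= sumEFin lee_fin fM.
Qed.

Lemma esum_ge_seq (R : realType) (T : choiceType) (f : T -> R) (s : seq T) :
  uniq s -> ((\sum_(i <- s) f i)%:E <= \esum_(i in [set: T]) (f i)%:E)%E.
Proof.
move=> us; apply: esum_ge; exists [set` s]; first by split.
by rewrite -fsbig_seq// sumEFin.
Qed.

Lemma esumZl (R : realType) (T : choiceType) (f : T -> R) (k : R) :
  0 <= k -> \esum_(i in [set: T]) (k * f i)%:E =
            (k%:E * \esum_(i in [set: T]) (f i)%:E)%E.
Proof.
move=> k0; rewrite /esum -ereal_supZl//; last first.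
  by apply/set0P; exists 0%E; exists set0; rewrite ?fsbig_set0//; exact: fsets_set0.
congr ereal_sup; rewrite image_comp; apply: eq_imagel => A [Afin _] /=.
by rewrite !fsbig_finite//= !sumEFin -EFinM mulr_sumr.
Qed.

Definition int_block (j0 : int) (L : nat) : seq int :=
  [seq j0 + k%:Z | k <- iota 0 L].

Lemma int_block_uniq (j0 : int) (L : nat) : uniq (int_block j0 L).
Proof. by rewrite map_inj_uniq ?iota_uniq// => i j /addrI []. Qed.

Lemma sum_int_block (V : nmodType) (j0 : int) (L : nat) (F : int -> V) :
  \sum_(l <- int_block j0 L) F l = \sum_(k < L) F (j0 + k%:Z).
Proof.
rewrite big_map -[L in iota 0 L]subn0 -/(index_iota 0 L).
by rewrite (big_mkord xpredT (fun k => F (j0 + k%:Z))).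
Qed.

Lemma sum_sub_uniq_le (R : numDomainType) (T : eqType) (s t : seq T) (F : T -> R) :
  uniq s -> uniq t -> {subset s <= t} -> (forall i, 0 <= F i) ->
  \sum_(i <- s) F i <= \sum_(i <- t) F i.
Proof.
move=> us ut st F0; rewrite [leRHS](bigID (mem s))/= -[leLHS]addr0 lerD//.
  rewrite -[leRHS]big_filter le_eqVlt; apply/orP; left; apply/eqP.
  apply/perm_big/uniq_perm.
  - exact: us.
  - exact: filter_uniq.
  - by move=> i; rewrite mem_filter andb_idr// => /st.
by rewrite sumr_ge0.
Qed.

Lemma seq_int_bounded (s : seq int) :
  exists B : nat, forall l, l \in s -> - B%:Z <= l <= B%:Z.
Proof.
elim: s => [|x s [B HB]]; first by exists 0%N.
exists (B + `|x|)%N => l; rewrite inE => /orP[/eqP->|/HB]; lia.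
Qed.

(** * Gaussian sums over the integers *)

Section gauss_sum.
Context (R : realType) (c a : R) (c_gt0 : 0 < c).

Let gauss (l : int) : R := expR (- (pi ^+ 2 * (l%:~R - a) ^+ 2 / c)).

(* The binomial law of size 2m at scale L approximates a Gaussian law of
   parameter c when L^2 / m tends to c. *)
Let L (k : nat) : nat := k.+1.
Let m (k : nat) : nat := (Num.truncn ((L k)%:R ^+ 2 / c)).+1.
Let d (k : nat) : R := (L k)%:R^-1.
Let x (k : nat) : R := (L k)%:R ^+ 2 / (m k)%:R.

Let Lp (k : nat) : 0 < (L k)%:R :> R. Proof. by rewrite ltr0n. Qed.
Let mp (k : nat) : 0 < (m k)%:R :> R. Proof. by rewrite ltr0n. Qed.
Let xp (k : nat) : 0 < x k.
Proof. by rewrite divr_gt0 ?exprn_gt0. Qed.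
Let dE (k : nat) : (L k)%:R = (d k)^-1. Proof. by rewrite invrK. Qed.
Let dp (k : nat) : 0 < d k. Proof. by rewrite invr_gt0. Qed.
Let mE (k : nat) : (m k)%:R = ((d k) ^+ 2 * x k)^-1.
Proof. by rewrite /x dE exprVn; field; rewrite !gt_eqF ?dp ?mp. Qed.

Let x_le (k : nat) : x k <= c.
Proof.
rewrite /x ler_pdivrMr// mulrC -ler_pdivrMr// ltW//.
by rewrite /m truncnS_gt.
Qed.

Let x_ge (k : nat) : c - c ^+ 2 * d k <= x k.
Proof.
have : (Num.truncn ((L k)%:R ^+ 2 / c))%:R <= (L k)%:R ^+ 2 / c.
  by rewrite truncn_le divr_ge0 ?exprn_ge0// ltW.
have -> : (Num.truncn ((L k)%:R ^+ 2 / c))%:R = (m k)%:R - 1 :> R.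
  by rewrite /m -natr1 addrK.
rewrite ler_pdivlMr// => H.
rewrite ler_pdivlMr//; apply: le_trans H.
have ltL : (L k)%:R ^+ 2 <= c * (m k)%:R by rewrite -ler_pdivrMr// x_le.
have cdm : 1 <= c * d k * (m k)%:R.
  rewrite mulrAC ler_pdivlMr// mul1r (le_trans _ ltL)//.
  by rewrite expr2 ler_peMl ?ler1n.
rewrite mulrBl mulrBl mul1r mulrC lerB// expr2 -!mulrA ler_peMr//; last by rewrite mulrA.
by rewrite ltW.
Qed.

Let cvg_d : d k @[k --> \oo] --> 0.
Proof. exact: cvg_harmonic. Qed.

Let cvg_x : x k @[k --> \oo] --> c.
Proof.
apply: (@squeeze_cvgr _ _ _ _ (fun k => c - c ^+ 2 * d k) (fun=> c)).
- by near=> k; rewrite x_ge x_le.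
- rewrite -[X in _ --> X](_ : c - c ^+ 2 * 0 = c); last by rewrite mulr0 subr0.
  by apply: cvgB; [exact: cvg_cst|apply: cvgMr].
- exact: cvg_cst.
Unshelve. all: by end_near. Qed.

(* The frequency zero of the equispaced sums. *)
Let w (k : nat) : R := (L k)%:R * return_prob R (m k).

Let w_le (k : nat) : w k <= Num.sqrt (x k / pi).
Proof.
rewrite -(@ger0_norm _ (w k)); last by rewrite mulr_ge0// ltW// return_prob_gt0.
rewrite -sqrtr_sqr ler_wsqrtr// exprMn.
have /= H := @return_prob_sqr_le R (m k) isT.
apply: le_trans (ler_wpM2l (sqr_ge0 _) H) _.
by rewrite invfM /x mulrA mulrAC.
Qed.

Let w_ge (k : nat) : Num.sqrt (x k / (1 + d k ^+ 2 * x k / 2) / pi) <= w k.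
Proof.
rewrite -(@ger0_norm _ (w k)); last by rewrite mulr_ge0// ltW// return_prob_gt0.
rewrite -sqrtr_sqr ler_wsqrtr// exprMn.
have /= H := @return_prob_sqr_ge R (m k).
apply: le_trans _ (ler_wpM2l (sqr_ge0 _) H).
have mhalf : (m k)%:R + 1 / 2 = (m k)%:R * (1 + d k ^+ 2 * x k / 2).
  by rewrite mE; field; rewrite !gt_eqF ?xp ?dp.
by rewrite le_eqVlt mhalf !invfM /x; apply/orP; left; apply/eqP; ring.
Qed.

(* The ratio of the geometric series in [cosX_equispaced_sum]. *)
Let p (k : nat) : R := expR (- (x k / (1 + d k * x k))).

Let cvg_dx : d k * x k @[k --> \oo] --> 0.
Proof. by rewrite -[X in _ --> X](mul0r c); apply: cvgM. Qed.

Let cvg_ddx : d k ^+ 2 * x k @[k --> \oo] --> 0.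
Proof.
rewrite -[X in _ --> X](mul0r 0).
under eq_fun do rewrite expr2 -mulrA.
by apply: cvgM.
Qed.

Let cvg_p : p k @[k --> \oo] --> expR (- c).
Proof.
have H1 : 1 + d k * x k @[k --> \oo] --> (1 : R).
  by rewrite -[X in _ --> X]addr0; apply: cvgD; [exact: cvg_cst|exact: cvg_dx].
have H2 : x k / (1 + d k * x k) @[k --> \oo] --> c / 1.
  by apply: cvgM; [exact: cvg_x|apply: cvgV; [exact: oner_neq0|exact: H1]].
rewrite divr1 in H2.
exact: (continuous_cvg _ (@continuous_expR R _) (cvgN H2)).
Qed.

Let err (u : R) : R := 2 * (u / (1 - u)).

Let cvg_err : err (p k) @[k --> \oo] --> err (expR (- c)).
Proof.
apply: cvgMr; apply: cvgM; first exact: cvg_p.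
apply: cvgV; first by rewrite gt_eqF// subr_gt0 expR_lt1 oppr_lt0.
by apply: cvgB; [exact: cvg_cst|exact: cvg_p].
Qed.

Let equispaced (k : nat) (b : R) :
  `|\sum_(j < L k) cos (pi * (j%:R - b) / (L k)%:R) ^+ (2 * m k) - w k|
    <= w k * err (p k).
Proof.
have := @cosX_equispaced_sum R (L k) (m k) b isT isT.
rewrite -/(w k) /err /p.
have -> // : (L k)%:R ^+ 2 / ((m k)%:R + (L k)%:R) = x k / (1 + d k * x k).
by rewrite mE dE; field; rewrite !gt_eqF ?xp ?dp// addr_gt0// mulr_gt0.
Qed.

Let err_ge0 (k : nat) : 0 <= err (p k).
Proof.
rewrite mulr_ge0// divr_ge0 ?expR_ge0// subr_ge0 expR_le1 oppr_le0.
by rewrite divr_ge0 ?ltW// addr_gt0// mulr_gt0.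
Qed.

Let cosX_le_gauss (k : nat) (t : R) : `|t / (L k)%:R| <= 1 / 2 ->
  cos (pi * t / (L k)%:R) ^+ (2 * m k) <= expR (- (pi ^+ 2 * t ^+ 2 / x k)).
Proof.
move=> tL.
have tpi : `|pi * t / (L k)%:R| <= pi / 2.
  rewrite -mulrA normrM ger0_norm ?pi_ge0// ler_wpM2l ?pi_ge0//.
  by rewrite -[2^-1]mul1r.
have -> : - (pi ^+ 2 * t ^+ 2 / x k) =
    (2 * m k)%:R * - ((pi * t / (L k)%:R) ^+ 2 / 2).
  by rewrite natrM mE dE; field; rewrite !gt_eqF ?xp ?dp.
rewrite expRM_natl lerXn2r// ?nnegrE ?expR_ge0 ?cos_le_gauss//.
by rewrite cos_ge0_pihalf// -ler_norml.
Qed.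

(* From 1 + u <= e^u at u = y / (1 - y) follows 1 - y >= e^(- y / (1 - y)). *)
Let gauss_le_cosX (k : nat) (t : R) : let y := (pi * t * d k) ^+ 2 / 2 in y < 1 ->
  expR (- (pi ^+ 2 * t ^+ 2 / x k) / (1 - y)) <=
  cos (pi * t / (L k)%:R) ^+ (2 * m k).
Proof.
move=> y y1; have y1' : 0 < 1 - y by rewrite subr_gt0.
have <- : (2 * m k)%:R * y = pi ^+ 2 * t ^+ 2 / x k.
  by rewrite natrM mE /y; field; rewrite !gt_eqF ?xp ?dp.
have -> : - ((2 * m k)%:R * y) / (1 - y) = (2 * m k)%:R * - (y / (1 - y)).
  by rewrite mulNr mulrN -mulrA.
rewrite expRM_natl lerXn2r ?nnegrE ?expR_ge0//.
  by apply: le_trans (cos_ge_quad _); exact: ltW y1'.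
apply: le_trans (cos_ge_quad _); rewrite -/(d k) -/y expRN.
rewrite -[leRHS]invrK lef_pV2 ?posrE ?expR_gt0 ?invr_gt0//.
apply: le_trans (expR_ge1Dx _); rewrite le_eqVlt; apply/orP; left; apply/eqP.
by field; rewrite gt_eqF.
Qed.

Let cvg_cosX (l : int) :
  cos (pi * (l%:~R - a) / (L k)%:R) ^+ (2 * m k) @[k --> \oo] --> gauss l.
Proof.
set t := l%:~R - a.
have td0 : t / (L k)%:R @[k --> \oo] --> 0.
  by rewrite -[X in _ --> X](mulr0 t); apply: cvgMr; exact: cvg_d.
have z0 : pi * t * d k @[k --> \oo] --> (0 : R).
  by rewrite -[X in _ --> X](mulr0 (pi * t)); apply: cvgMr; exact: cvg_d.
have y0 : (pi * t * d k) ^+ 2 / 2 @[k --> \oo] --> (0 : R).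
  rewrite -[X in _ --> X](mul0r (2^-1 : R)); apply: cvgMl.
  by rewrite -[X in _ --> X](mul0r (0 : R)); exact: (cvgM z0 z0).
have gx : - (pi ^+ 2 * t ^+ 2 / x k) @[k --> \oo] --> - (pi ^+ 2 * t ^+ 2 / c).
  by apply: cvgN; apply: cvgMr; apply: cvgV; [rewrite gt_eqF|exact: cvg_x].
have gy : - (pi ^+ 2 * t ^+ 2 / x k) / (1 - (pi * t * d k) ^+ 2 / 2) @[k --> \oo]
    --> - (pi ^+ 2 * t ^+ 2 / c) / (1 - 0).
  apply: cvgM gx _; apply: cvgV; first by rewrite subr0 oner_neq0.
  by apply: cvgB; [exact: cvg_cst|exact: y0].
rewrite subr0 divr1 in gy.
apply: (@squeeze_cvgr _ _ _ _
  (fun k => expR (- (pi ^+ 2 * t ^+ 2 / x k) / (1 - (pi * t * d k) ^+ 2 / 2)))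
  (fun k => expR (- (pi ^+ 2 * t ^+ 2 / x k)))).
- near=> k; rewrite gauss_le_cosX/= ?cosX_le_gauss//.
    by near: k; apply: (cvgr0_norm_le _ td0).
  by near: k; apply: (cvgr_lt _ y0).
- exact: (continuous_cvg _ (@continuous_expR R _) gy).
- exact: (continuous_cvg _ (@continuous_expR R _) gx).
Unshelve. all: by end_near. Qed.

Let gauss_sum_le (s : seq int) : uniq s ->
  \sum_(l <- s) gauss l <= Num.sqrt (c / pi) * (1 + err (expR (- c))).
Proof.
move=> us; have [B HB] := seq_int_bounded s.
have cvg_s : \sum_(l <- s) cos (pi * (l%:~R - a) / (L k)%:R) ^+ (2 * m k)
    @[k --> \oo] --> \sum_(l <- s) gauss l.
  elim: s {us HB} => [|l s IH].
    by rewrite big_nil; under eq_fun do rewrite big_nil; exact: cvg_cst.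
  rewrite big_cons; under eq_fun do rewrite big_cons.
  by apply: cvgD; [exact: cvg_cosX|exact: IH].
have cvg_b : Num.sqrt (x k / pi) * (1 + err (p k)) @[k --> \oo] -->
    Num.sqrt (c / pi) * (1 + err (expR (- c))).
  apply: cvgM; last by apply: cvgD; [exact: cvg_cst|exact: cvg_err].
  apply: (continuous_cvg _ (@sqrt_continuous R _)).
  by apply: cvgMl; exact: cvg_x.
apply: ler_cvg_to cvg_s cvg_b _; near=> k.
apply: (@le_trans _ _ (\sum_(l <- int_block (- B%:Z) (L k))
    cos (pi * (l%:~R - a) / (L k)%:R) ^+ (2 * m k))).
  apply: sum_sub_uniq_le => //; first exact: int_block_uniq.
  - move=> l /HB /andP[Bl lB]; apply/mapP; exists `|(l + B%:Z)%R|%N; last by lia.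
    have kB : (2 * B <= k)%N by near: k; exact: nbhs_infty_ge.
    by rewrite mem_iota /L; lia.
  - by move=> l; rewrite exprM exprn_ge0// sqr_ge0.
rewrite sum_int_block.
have := @equispaced k (a + B%:R); rewrite ler_norml => /andP[_].
rewrite lerBlDl -{1}(mulr1 (w k)) -mulrDr => H.
apply: (@le_trans _ _ (w k * (1 + err (p k)))); last first.
  by rewrite ler_wpM2r ?addr_ge0.
apply: le_trans H; rewrite le_eqVlt; apply/orP; left; apply/eqP.
apply: eq_bigr => j _; congr (cos (pi * _ / _) ^+ _).
by rewrite rmorphD rmorphN /= -!pmulrn; ring.
Unshelve. all: by end_near. Qed.

Let gauss_sum_ge (S : R) :
  (forall s : seq int, uniq s -> \sum_(l <- s) gauss l <= S) ->
  Num.sqrt (c / pi) * (1 - err (expR (- c))) <= S.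
Proof.
move=> HS.
have cvg_b : Num.sqrt (x k / (1 + d k ^+ 2 * x k / 2) / pi)
      - Num.sqrt (x k / pi) * err (p k) @[k --> \oo] -->
    Num.sqrt (c / (1 + 0 / 2) / pi) - Num.sqrt (c / pi) * err (expR (- c)).
  apply: cvgB.
    apply: (continuous_cvg _ (@sqrt_continuous R _)); apply: cvgMl.
    apply: cvgM; [exact: cvg_x|apply: cvgV; first by rewrite mul0r addr0 oner_neq0].
    by apply: cvgD; [exact: cvg_cst|apply: cvgMl; exact: cvg_ddx].
  apply: cvgM; last exact: cvg_err.
  apply: (continuous_cvg _ (@sqrt_continuous R _)).
  by apply: cvgMl; exact: cvg_x.
rewrite mul0r addr0 divr1 in cvg_b.
rewrite mulrBr mulr1; apply: cvgr_to_le cvg_b _; near=> k.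
(* The block of L consecutive integers centred at a. *)
pose j0 : int := - Num.floor ((L k)%:R / 2 - a).
have [j0l j0r] : - ((L k)%:R / 2) <= j0%:~R - a /\ j0%:~R - a < - ((L k)%:R / 2) + 1.
  have /andP[h1 h2] := floor_itv ((L k)%:R / 2 - a).
  rewrite rmorphD /= in h2.
  rewrite /j0 rmorphN /=; split; lra.
apply: (@le_trans _ _ (w k * (1 - err (p k)))).
  rewrite mulrBr mulr1 lerB// ler_wpM2r//.
have := @equispaced k (a - j0%:~R); rewrite ler_norml => /andP[+ _].
rewrite lerBrDl -{1}(mulr1 (w k)) -mulrBr => H.
apply: le_trans H _; apply: le_trans (HS _ (int_block_uniq j0 (L k))).
rewrite sum_int_block; apply: ler_sum => j _.
have -> : j%:R - (a - j0%:~R) = (j0 + j%:Z)%:~R - a :> R.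
  by rewrite rmorphD /= -pmulrn; ring.
have jL : j%:R <= (L k)%:R - 1 :> R.
  by rewrite lerBrDr natr1 ler_nat ltn_ord.
have j0' : 0 <= j%:R :> R by [].
apply: le_trans (cosX_le_gauss _) _.
  rewrite normrM normfV (ger0_norm (ler0n R _)) ler_pdivrMr//.
  rewrite ler_norml rmorphD /= -pmulrn.
  by apply/andP; split; lra.
rewrite /gauss ler_expR lerN2 -exprMn ler_wpM2l ?sqr_ge0//.
by rewrite lef_pV2 ?posrE.
Unshelve. all: by end_near. Qed.

(** A quantitative form of the theta transformation formula. The main term is the
    frequency zero in Poisson summation; the first neglected frequencies
    contribute [2 * expR (- c) * cos (2 * pi * a)] relatively to it, so the rate of
    the error is sharp. *)
Lemma gauss_sum_asymp : exists S : R,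
  \esum_(l in [set: int]) (expR (- (pi ^+ 2 * (l%:~R - a) ^+ 2 / c)))%:E = S%:E /\
  `|S - Num.sqrt (c / pi)| <=
    Num.sqrt (c / pi) * (2 * (expR (- c) / (1 - expR (- c)))).
Proof.
have H1 := esum_le_seq gauss_sum_le.
have H2 := esum_ge_seq gauss.
have H0 : (0 <= \esum_(i in [set: int]) (gauss i)%:E)%E.
  by apply: esum_ge0 => l _; rewrite lee_fin expR_ge0.
move: H0 H1 H2; rewrite -/(gauss _).
case: (\esum_(i in [set: int]) (gauss i)%:E)%E => [S| |]//= _ H1 H2.
exists S; split=> //.
have {}H1 : S <= Num.sqrt (c / pi) * (1 + err (expR (- c))) by rewrite -lee_fin.
have {}H2 := gauss_sum_ge (fun s us => H2 s us).
by rewrite ler_norml; apply/andP; split; rewrite /err in H1 H2; lra.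
Qed.

End gauss_sum.

(** * Factors that are exponentially close to 1 *)

(** Multiplicative closeness to 1: unlike a bound on [X - 1], it passes to
    products and to real powers with errors that just add up and scale. *)
Definition exp_close (R : realType) (b X : R) : Prop :=
  expR (- b) <= X <= expR b.

Section exp_close.
Context (R : realType).
Implicit Types (b X x : R).

Lemma exp_close_gt0 b X : exp_close b X -> 0 < X.
Proof. by move=> /andP[bX _]; apply: lt_le_trans bX; exact: expR_gt0. Qed.

Lemma exp_close_le b b' X : b <= b' -> exp_close b X -> exp_close b' X.
Proof.
move=> bb' /andP[bX Xb]; apply/andP; split.
- by apply: le_trans bX; rewrite ler_expR lerN2.
- by apply: le_trans Xb _; rewrite ler_expR.
Qed.

Lemma exp_close_ln b X : exp_close b X -> `|ln X| <= b.
Proof.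
move=> bX; have X0 := exp_close_gt0 bX.
by rewrite ler_norml -(ler_expR (- b)) -(ler_expR (ln X)) lnK.
Qed.

Lemma exp_closeM b X b' X' :
  exp_close b X -> exp_close b' X' -> exp_close (b + b') (X * X').
Proof.
move=> bX bX'; have X0 := exp_close_gt0 bX; have X'0 := exp_close_gt0 bX'.
move: bX bX' => /andP[bX Xb] /andP[bX' Xb'].
by apply/andP; split; rewrite ?opprD expRD ler_pM ?expR_ge0 ?(ltW X0) ?(ltW X'0).
Qed.

Lemma exp_closeV b X : exp_close b X -> exp_close b X^-1.
Proof.
move=> bX; have X0 := exp_close_gt0 bX; move/andP: bX => [bX Xb].
apply/andP; split; first by rewrite expRN lef_pV2 ?posrE ?expR_gt0.
by rewrite -[leRHS]invrK -expRN lef_pV2 ?posrE ?expR_gt0.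
Qed.

Lemma exp_close_powR b X x : exp_close b X -> exp_close (`|x| * b) (X `^ x).
Proof.
move=> bX; have X0 := exp_close_gt0 bX.
have := exp_close_ln bX; rewrite /powR gt_eqF// => lnX.
by rewrite /exp_close !ler_expR -ler_norml normrM ler_wpM2l.
Qed.

Lemma exp_close_prod (I : Type) (r : seq I) (P : pred I) (b X : I -> R) :
  (forall i, P i -> exp_close (b i) (X i)) ->
  exp_close (\sum_(i <- r | P i) b i) (\prod_(i <- r | P i) X i).
Proof.
move=> bX; elim/big_rec2: _ => [|i b' X' Pi]; last by apply: exp_closeM; exact: bX.
by rewrite /exp_close oppr0 expR0 lexx.
Qed.

Lemma exp_close_oneB x : `|x| <= 1 / 2 -> exp_close (2 * `|x|) (1 - x).
Proof.
move=> x2; have := x2; rewrite ler_norml => /andP[x2l x2r].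
have x1 : 0 < 1 - x by lra.
apply/andP; split; last first.
  apply: le_trans (expR_ge1Dx _) _.
  by rewrite ler_expR; have := ler_norm (- x); have := normr_ge0 x; rewrite normrN; lra.
rewrite expRN -[leRHS]invrK lef_pV2 ?posrE ?expR_gt0 ?invr_gt0//.
apply: le_trans (expR_ge1Dx _).
rewrite -[(1 - x)^-1]mul1r ler_pdivrMr//.
have -> : (1 + 2 * `|x|) * (1 - x) = 1 + (2 * `|x| - x - 2 * `|x| * x) by ring.
rewrite lerDl subr_ge0.
have := ler_norm x; have : 2 * `|x| * x <= 2 * `|x| * (1 / 2).
  by rewrite ler_wpM2l ?mulr_ge0.
lra.
Qed.

(** A product of such factors is the exponential of an absolutely convergent
    series, and every partial product already satisfies the bound. *)
Lemma exp_close_infprod b q (u : nat -> R) : 0 <= b -> 0 <= q <= 1 / 2 ->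
  (forall m, (0 < m)%N -> exp_close (b * q ^+ m) (u m)) ->
  exp_close (2 * b * q) (infprod u).
Proof.
move=> b0 /andP[q0 q2] bu; pose v k := ln (u k.+1).
have partial M : \prod_(1 <= m < M.+1) u m = expR (series v M).
  rewrite /series /= expR_sum big_add1 /=; apply: eq_bigr => k _.
  by rewrite lnK// posrE (exp_close_gt0 (bu k.+1 isT)).
have cvg_prod : cvgn (fun M => \prod_(1 <= m < M.+1) u m).
  suff /cvg_ex[l vl] : cvgn (series v).
    apply/cvg_ex; exists (expR l); under eq_fun do rewrite partial.
    exact: (continuous_cvg _ (@continuous_expR R _) vl).
  apply: normed_cvg; apply: (@series_le_cvg _ _ (geometric (b * q) q)).
  - by move=> k /=.
  - by move=> k /=; rewrite !mulr_ge0 ?exprn_ge0.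
  - move=> k /=; rewrite -mulrA -exprS.
    exact: exp_close_ln (bu k.+1 isT).
  - by apply: is_cvg_geometric_series; rewrite ger0_norm//; lra.
have bound M : exp_close (2 * b * q) (\prod_(1 <= m < M.+1) u m).
  apply: (@exp_close_le (\sum_(0 <= k < M) b * q ^+ k.+1)).
    rewrite -mulr_sumr (mulrC 2) -mulrA ler_wpM2l//.
    apply: le_trans (geometric_sum_le M _) _; first by rewrite q0; lra.
    rewrite ler_pdivrMr; last lra.
    by rewrite -subr_ge0 (_ : _ - _ = q * (1 - 2 * q)) ?mulr_ge0//; [lra|ring].
  rewrite big_add1 /= !big_mkord; apply: exp_close_prod => i _.
  exact: bu.
apply/andP; split.
- by apply: limr_ge => //; apply: nearW => M; case/andP: (bound M).
- by apply: limr_le => //; apply: nearW => M; case/andP: (bound M).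
Qed.

End exp_close.

(** * Theta functions at a large modulus *)

Section theta_close.
Context (R : realType) (r : R) (r_large : 5 <= r).
Let q : R := expR (- r).

Let q_gt0 : 0 < q. Proof. exact: expR_gt0. Qed.

Let q_le : q <= 1 / 6.
Proof.
rewrite /q expRN div1r lef_pV2 ?posrE ?expR_gt0//.
have r5 := r_large.
by rewrite (le_trans _ (expR_ge1Dx _))//; lra.
Qed.

Let q01 : 0 <= q <= 1 / 2.
Proof. by have q0 := q_gt0; have q6 := q_le; apply/andP; split; lra. Qed.

Let qX (m : nat) : q ^+ m = expR (- (m%:R * r)).
Proof. by rewrite -expRM_natl mulrN. Qed.

Let qX_le (m : nat) : (0 < m)%N -> q ^+ m <= q.
Proof.
have q0 := q_gt0; have q6 := q_le.
by case: m => // m _; rewrite exprS ler_piMr ?exprn_ile1//; lra.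
Qed.

Let even_le (m : nat) : expR (- (2 * m%:R * r)) <= q ^+ m.
Proof.
have r5 := r_large.
by rewrite qX ler_expR lerN2 -mulrA ler_peMl ?ler1n// mulr_ge0//; lra.
Qed.

Let odd_le (m : nat) : (0 < m)%N -> expR (- ((2 * m%:R - 1) * r)) <= q ^+ m.
Proof.
move=> m0; have r5 := r_large; have m1 : 1 <= m%:R :> R by rewrite ler1n.
by rewrite qX ler_expR lerN2 ler_wpM2r; lra.
Qed.

Let one_close (m : nat) : (0 < m)%N ->
  exp_close (2 * q ^+ m) (1 - expR (- (2 * m%:R * r))).
Proof.
move=> m0; have h2 := even_le m; have h1 := qX_le m0; have q6 := q_le.
apply: exp_close_le (exp_close_oneB _); rewrite ger0_norm ?expR_ge0//; lra.
Qed.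

Let factor_close (m : nat) (t z : R) : (0 < m)%N -> 0 <= t <= q ^+ m ->
  exp_close (6 * q ^+ m) (theta_factor t z).
Proof.
move=> m0 /andP[t0 tm]; have tq := qX_le m0; have q6 := q_le.
have -> : theta_factor t z = 1 - (2 * t * cos z - t ^+ 2).
  by rewrite theta_factorE; ring.
have tt : t ^+ 2 <= t by rewrite expr2 ler_piMl//; lra.
have tt0 : 0 <= t ^+ 2 by rewrite sqr_ge0.
have tc : `|2 * t * cos z| <= 2 * t.
  by rewrite normrM ger0_norm ?ler_piMr ?cos_max ?mulr_ge0.
have h : `|2 * t * cos z - t ^+ 2| <= 3 * t.
  move: tc; rewrite !ler_norml => /andP[h1 h2]; apply/andP; split; lra.
by apply: exp_close_le (exp_close_oneB _); lra.
Qed.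

Let theta_close (t : nat -> R) (z : R) :
  (forall m, (0 < m)%N -> 0 <= t m <= q ^+ m) ->
  exp_close (16 * q)
    (infprod (fun m => (1 - expR (- (2 * m%:R * r))) * theta_factor (t m) z)).
Proof.
move=> tq; rewrite (_ : 16 = 2 * 8); last by rewrite -natrM.
apply: exp_close_infprod => // m m0.
rewrite (_ : 8 * q ^+ m = 2 * q ^+ m + 6 * q ^+ m); last by ring.
by apply: exp_closeM; [exact: one_close|exact/factor_close/tq].
Qed.

Lemma Theta3_close z : exp_close (16 * q) (Theta3 r z).
Proof. by apply: theta_close => m m0; rewrite expR_ge0 odd_le. Qed.

(** [Theta1] without its prefactor, which carries its zeros and its decay. *)
Definition Theta1_prod z := infprod (fun m : nat =>
  (1 - expR (- (2 * m%:R * r))) * theta_factor (expR (- (2 * m%:R * r))) z).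

Lemma Theta1_prod_close z : exp_close (16 * q) (Theta1_prod z).
Proof. by apply: theta_close => m m0; rewrite expR_ge0 even_le. Qed.

Lemma norm_Theta1 (a b : R) : `|Theta1 r (b - a)| =
  expR (- (r / 4)) * normc (expi a - expi b) * Theta1_prod (b - a).
Proof.
have T0 := exp_close_gt0 (Theta1_prod_close (b - a)).
have /= -> := normc_expiB a b.
rewrite /Theta1 -/(Theta1_prod _) !normrM (ger0_norm (ltW T0)).
by rewrite (ger0_norm (expR_ge0 _)) ger0_norm//; ring.
Qed.

Lemma infprod_powR_close (x : R) :
  exp_close (4 * `|x| * q)
    (infprod (fun m => (1 - expR (- (2 * m%:R * r))) `^ x)).
Proof.
rewrite (_ : 4 * `|x| = 2 * (2 * `|x|)); last by ring.
apply: exp_close_infprod => [||m m0]; rewrite ?mulr_ge0//.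
rewrite (_ : 2 * `|x| * q ^+ m = `|x| * (2 * q ^+ m)); last by ring.
exact: (exp_close_powR x (one_close m0)).
Qed.

(** * Asymptotics of the single terms *)

(** The square root leaves one factor [expR (- (r / 4))] per pair of indices, out of
    the two that come from the [Theta1] prefactors. *)
Lemma cross_ratio_close (a1 a2 b1 b2 : R) : exists2 X, exp_close (32 * q) X &
  (`|Theta1 r (a2 - a1) * Theta1 r (b2 - b1)| /
    `|Theta3 r (b2 - a1) * Theta3 r (b1 - a2)|) `^ (1 / 2) =
  expR (- (r / 4)) *
    (normc (expi a1 - expi a2) `^ (1 / 2) * normc (expi b1 - expi b2) `^ (1 / 2)) * X.
Proof.
have normc_ge0 (u v : R) : 0 <= normc (expi u - expi v).
  by have /= -> := normc_expiB u v; rewrite mulr_ge0.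
have Ta := Theta1_prod_close (a2 - a1); have Tb := Theta1_prod_close (b2 - b1).
have T1 := Theta3_close (b2 - a1); have T2 := Theta3_close (b1 - a2).
pose Y := Theta1_prod (a2 - a1) * Theta1_prod (b2 - b1) *
  (Theta3 r (b2 - a1) * Theta3 r (b1 - a2))^-1.
have q0 := q_gt0.
have YC : exp_close (64 * q) Y.
  rewrite (_ : 64 * q = 16 * q + 16 * q + (16 * q + 16 * q)); last by ring.
  by apply: exp_closeM; [exact: exp_closeM|apply/exp_closeV/exp_closeM].
exists (Y `^ (1 / 2)).
  apply: exp_close_le (exp_close_powR _ YC).
  by rewrite ger0_norm//; lra.
rewrite normrM !norm_Theta1 [`|Theta3 _ _ * _|]ger0_norm; last first.
  by rewrite mulr_ge0// ltW// (exp_close_gt0 T1, exp_close_gt0 T2).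
rewrite (_ : _ * _ * _ * _ / _ =
  expR (- (r / 2)) * (normc (expi a1 - expi a2) * normc (expi b1 - expi b2)) * Y);
  last first.
  have -> : expR (- (r / 2)) = expR (- (r / 4)) * expR (- (r / 4)).
    by rewrite -expRD; congr expR; field.
  by rewrite /Y; ring.
move: (Y) (ltW (exp_close_gt0 YC)) => Z Z0.
rewrite !powRM ?mulr_ge0 ?expR_ge0// -expRM.
by rewrite (_ : - (r / 2) * (1 / 2) = - (r / 4))//; field.
Qed.

End theta_close.

Lemma sum_ord_pairs (V : nmodType) (n : nat) (x : V) :
  \sum_(i < n) \sum_(k < n | (i < k)%N) x = x *+ 'C(n, 2).
Proof.
rewrite -bin2_sum big_mkord (exchange_big_dep predT)//= -sumrMnr.
apply: eq_bigr => k _; rewrite -(big_ord_widen n (fun=> x) (ltnW (ltn_ord k))).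
by rewrite sumr_const card_ord.
Qed.

(** Each of the [n] indices contributes 6 through the infinite product and 8
    through its [Theta3] factor; each pair of indices contributes 32. *)
Definition error_const (n : nat) : nat := 14 * n + 32 * 'C(n, 2).

(** The dependence on [l] is confined to a Gaussian factor; all the others
    tend to 1 apart from [Zrad alpha * Zrad beta] and a power of [expR r]. *)
Lemma Zcro_l_factor (R : realType) (n : nat) (r : R) (alpha beta : 'I_n -> R) :
  5 <= r -> exists2 X, exp_close ((error_const n)%:R * expR (- r)) X &
  forall l : int, Zcro_l l r alpha beta =
    Zrad alpha * Zrad beta * expR (n%:R * (2 - n%:R) * r / 8) * X *
    expR (- (1 / (8 * r) *
      (\sum_(j < n) (alpha j - beta j) - 2 * n%:R * pi * l%:~R) ^+ 2)).
Proof.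
move=> r5; set q := expR (- r).
pose P i k := (`|Theta1 r (alpha k - alpha i) * Theta1 r (beta k - beta i)| /
     `|Theta3 r (beta k - alpha i) * Theta3 r (beta i - alpha k)|) `^ (1 / 2).
pose N (theta : 'I_n -> R) i k := normc (expi (theta i) - expi (theta k)) `^ (1 / 2).
have /choice[X HX] : forall ik : 'I_n * 'I_n, exists X, exp_close (32 * q) X /\
    P ik.1 ik.2 = expR (- (r / 4)) * (N alpha ik.1 ik.2 * N beta ik.1 ik.2) * X.
  move=> [i k] /=.
  have [X] := cross_ratio_close r5 (alpha i) (alpha k) (beta i) (beta k).
  by exists X.
pose Xinf := infprod (fun m => (1 - expR (- (2 * m%:R * r))) `^ (3 * n%:R / 2)).
pose X3 := \prod_(j < n) `|Theta3 r (beta j - alpha j)| `^ (- (1 / 2)).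
pose Xp := \prod_(i < n) \prod_(k < n | (i < k)%N) X (i, k).
have XinfC : exp_close (6 * n%:R * q) Xinf.
  apply: exp_close_le (infprod_powR_close r5 _).
  by rewrite ger0_norm// le_eqVlt; apply/orP; left; apply/eqP; rewrite /q; field.
have X3C : exp_close (8 * n%:R * q) X3.
  rewrite (_ : 8 * n%:R * q = \sum_(j < n) (8 * q)); last first.
    by rewrite sumr_const card_ord -mulr_natr; ring.
  apply: exp_close_prod => j _; have T := Theta3_close r5 (beta j - alpha j).
  rewrite (ger0_norm (ltW (exp_close_gt0 T))).
  apply: exp_close_le (exp_close_powR _ T).
  by rewrite normrN ger0_norm// le_eqVlt; apply/orP; left; apply/eqP; rewrite /q; field.
have XpC : exp_close (32 * 'C(n, 2)%:R * q) Xp.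
  rewrite (_ : 32 * _ * q = \sum_(i < n) \sum_(k < n | (i < k)%N) (32 * q)); last first.
    by rewrite sum_ord_pairs -mulr_natr; ring.
  by apply: exp_close_prod => i _; apply: exp_close_prod => k _; case: (HX (i, k)).
exists (Xinf * X3 * Xp).
  rewrite (_ : _%:R * q = 6 * n%:R * q + 8 * n%:R * q + 32 * 'C(n, 2)%:R * q); last first.
    by rewrite /error_const natrD !natrM; ring.
  by apply: exp_closeM => //; apply: exp_closeM.
move=> l; rewrite /Zcro_l.
have -> : \prod_(i < n) \prod_(k < n | (i < k)%N) P i k =
    expR (- (r / 4) * 'C(n, 2)%:R) * (Zrad alpha * Zrad beta) * Xp.
  rewrite /Zrad /Xp.
  have -> : expR (- (r / 4) * 'C(n, 2)%:R) =
      \prod_(i < n) \prod_(k < n | (i < k)%N) expR (- (r / 4)).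
    rewrite mulr_natr -sum_ord_pairs expR_sum; apply: eq_bigr => i _.
    by rewrite expR_sum.
  rewrite -!big_split /=; apply: eq_bigr => i _.
  rewrite -!big_split /=; apply: eq_bigr => k _.
  by have [_ /= ->] := HX (i, k).
have binR : 'C(n, 2)%:R = n%:R * (n%:R - 1) / 2 :> R.
  case: (n) => [|n']; first by rewrite mul0r mul0r.
  have := bin2_sum n'.+1; have := mul_bin_diag n'.+1 1.
  rewrite /= bin1 => E _.
  apply: (@mulfI _ 2) => //; rewrite -natrM -E natrM -natr1 addrK.
  by field.
rewrite -/Xinf -/X3 expRD.
have -> : expR (n%:R * (2 - n%:R) * r / 8) =
    expR (n%:R * r / 8) * expR (- (r / 4) * 'C(n, 2)%:R).
  by rewrite -expRD binR; congr expR; field.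
by ring.
Qed.

Lemma Zrad_ge0 (R : realType) (n : nat) (theta : 'I_n -> R) : 0 <= Zrad theta.
Proof.
by rewrite /Zrad; do 2![apply: prodr_ge0 => ? _]; rewrite powR_ge0.
Qed.

(** In terms of [c = 2 * r / n ^+ 2] and of the mean angle difference [a] in
    full turns, the Gaussian factor of [Zcro_l_factor] is the one of
    [gauss_sum_asymp], whose rate [expR (- c)] is the second rate of the error. *)
Lemma Zcro_close (R : realType) (n : nat) (r : R) (alpha beta : 'I_n -> R) :
  (0 < n)%N -> 5 <= r -> 7 <= 2 * r / n%:R ^+ 2 ->
  exists2 X, exp_close (((error_const n)%:R + 8) *
                        (expR (- r) + expR (- (2 * r / n%:R ^+ 2)))) X &
  Zcro r alpha beta = (Zrad alpha * Zrad beta / (n%:R * Num.sqrt (pi / 2)) *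
    expR (n%:R * (2 - n%:R) * r / 8 + ln r / 2) * X)%:E.
Proof.
move=> n0 r5 c7; set c := 2 * r / n%:R ^+ 2 in c7 *.
have nR : 0 < n%:R :> R by rewrite ltr0n.
have r0 : 0 < r by lra.
have c0 : 0 < c by lra.
have pi0 := pi_gt0 R.
have [X XC XE] := Zcro_l_factor alpha beta r5.
pose a := (\sum_(j < n) (alpha j - beta j)) / (2 * n%:R * pi).
have [S [SE SC]] := gauss_sum_asymp a c0.
set p := expR (- c) in SC *.
have p0 : 0 < p by exact: expR_gt0.
have p8 : p <= 1 / 8.
  rewrite /p expRN div1r lef_pV2 ?posrE ?expR_gt0//.
  by rewrite (le_trans _ (expR_ge1Dx _))//; lra.
have sq0 : 0 < Num.sqrt (c / pi) by rewrite sqrtr_gt0 divr_gt0.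
pose Y := S / Num.sqrt (c / pi).
have YC : exp_close (8 * p) Y.
  have h : `|1 - Y| <= 4 * p.
    rewrite distrC -(ler_pM2l sq0) -{1}(ger0_norm (ltW sq0)) -normrM.
    rewrite mulrBr mulr1 /Y mulrCA divff ?gt_eqF// mulr1.
    apply: le_trans SC _; rewrite (ler_wpM2l (ltW sq0))//.
    rewrite mulrA ler_pdivrMr; last by lra.
    nra.
  by rewrite -(subKr 1 Y); apply: exp_close_le (exp_close_oneB _); lra.
exists (X * Y).
  rewrite mulrDr; apply: exp_close_le (exp_closeM XC YC).
  have q0 := expR_gt0 (- r); rewrite mulrDl.
  have A0 : 0 <= (error_const n)%:R * p :> R by rewrite mulr_ge0 ?(ltW p0).
  by rewrite !mulrDl; lra.
have expE (l : int) : 1 / (8 * r) *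
    (\sum_(j < n) (alpha j - beta j) - 2 * n%:R * pi * l%:~R) ^+ 2 =
    pi ^+ 2 * (l%:~R - a) ^+ 2 / c.
  rewrite /a /c; move: (\sum_(j < n) _) (l%:~R) (@pi R) pi0 => A u t t0.
  by field; rewrite !gt_eqF.
rewrite /Zcro; under eq_esum do rewrite XE expE.
rewrite esumZl; last first.
  rewrite mulr_ge0 ?(ltW (exp_close_gt0 XC))// mulr_ge0 ?expR_ge0//.
  by rewrite mulr_ge0 ?Zrad_ge0.
rewrite SE -EFinM; congr EFin.
have -> : S = Num.sqrt (c / pi) * Y by rewrite /Y mulrC mulfVK ?gt_eqF.
have -> : Num.sqrt (c / pi) = expR (ln r / 2) / (n%:R * Num.sqrt (pi / 2)).
  have sqr : expR (ln r / 2) = Num.sqrt r.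
    by rewrite -powR12_sqrt ?ltW// /powR gt_eqF// mulrC.
  have -> : c / pi = (Num.sqrt r / (n%:R * Num.sqrt (pi / 2))) ^+ 2.
    rewrite exprMn exprVn exprMn !sqr_sqrtr ?divr_ge0 ?ltW// /c.
    by move: (@pi R) pi0 => t t0; field; rewrite !gt_eqF.
  by rewrite sqrtr_sqr sqr ger0_norm// divr_ge0 ?mulr_ge0 ?sqrtr_ge0.
by rewrite expRD; ring.
Qed.

(** * Rotated boundary points *)

(** Squaring makes the product run over ordered pairs, so that it becomes visibly
    symmetric in the points. *)
Lemma Zrad_sqr (R : realType) (n : nat) (theta : 'I_n -> R) :
  Zrad theta ^+ 2 = \prod_(i < n) \prod_(j < n | j != i)
    normc (expi (theta i) - expi (theta j)) `^ (1 / 2).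
Proof.
pose N i j : R := normc (expi (theta i) - expi (theta j)) `^ (1 / 2).
have NC i j : N i j = N j i.
  rewrite /N; have /= -> := normc_expiB (theta i) (theta j).
  have /= -> := normc_expiB (theta j) (theta i).
  by rewrite -(opprB (theta i)) mulNr sinN normrN.
transitivity (\prod_(i < n) ((\prod_(j < n | (i < j)%N) N i j) *
                             (\prod_(j < n | (j < i)%N) N i j))).
  rewrite big_split /= expr2; congr (_ * _).
  rewrite /Zrad (exchange_big_dep predT)//=.
  by apply: eq_bigr => i _; apply: eq_bigr => j _; exact: NC.
apply: eq_bigr => i _; rewrite [RHS](bigID (fun j : 'I_n => (i < j)%N))/=.
by congr (_ * _); apply: eq_bigl => j; rewrite -val_eqE /=; lia.
Qed.

Lemma expiD2pi (R : realType) (t : R) (k : nat) :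
  expi (t + k%:R * (2 * pi)) = expi t.
Proof.
rewrite /expi (_ : k%:R * (2 * pi) = (pi *+ 2) *+ k).
  by rewrite (periodicn (@sinD2pi R)) (periodicn (@cosD2pi R)).
by rewrite !mulr_natl.
Qed.

Lemma Zrad_shift (R : realType) (n k : nat) (theta : 'I_n -> R) :
  Zrad (shift_angles k theta) = Zrad theta.
Proof.
apply/eqP; rewrite -(eqrXn2 (n := 2)) ?Zrad_ge0//; apply/eqP; rewrite !Zrad_sqr.
pose s (j : 'I_n) : 'I_n :=
  Ordinal (ltn_pmod (k + j) (leq_ltn_trans (leq0n j) (ltn_ord j))).
have s_inj : injective s.
  move=> i j /(congr1 val) /= /eqP; rewrite eqn_modDl.
  by rewrite !modn_small ?ltn_ord// => /eqP /val_inj.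
have sE j : expi (shift_angles k theta j) = expi (theta (s j)) by exact: expiD2pi.
rewrite [RHS](reindex_inj s_inj); apply: eq_bigr => i _.
rewrite [RHS](reindex_inj s_inj); apply: eq_big => j; first by rewrite (inj_eq s_inj).
by rewrite !sE.
Qed.

(** * The asymptotics *)

(** Uniformity in the angles is what allows finitely many rotated
    configurations to be averaged with a common constant. *)
Lemma Zcro_asymp (R : realType) (n : nat) : (0 < n)%N ->
  exists C : R, \forall r \near +oo, forall alpha beta : 'I_n -> R,
    exists2 X, exp_close (C * (expR (- r) + expR (- (2 * r / n%:R ^+ 2)))) X &
    Zcro r alpha beta = (Zrad alpha * Zrad beta / (n%:R * Num.sqrt (pi / 2)) *
      expR (n%:R * (2 - n%:R) * r / 8 + ln r / 2) * X)%:E.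
Proof.
move=> n0; have nR : 0 < n%:R :> R by rewrite ltr0n.
have large (x : R) : \forall r \near +oo, x <= r.
  by apply: nbhs_pinfty_ge; exact: num_real.
exists ((error_const n)%:R + 8).
apply: filterS2 (large 5) (large (7 * n%:R ^+ 2 / 2)) => r r5 rn alpha beta.
apply: Zcro_close => //.
by rewrite ler_pdivlMr ?exprn_gt0//; lra.
Qed.

Lemma exp_close_error (R : realType) (C K : R) (B G : R -> R) (Z : R -> \bar R) :
  (\forall r \near +oo, exists2 X, exp_close (C * B r) X &
     Z r = (K * expR (G r) * X)%:E) ->
  exists (C' : R) (E : R -> R), \forall r \near +oo,
    `|E r| <= C' * B r /\ Z r = (K * expR (G r + E r))%:E.
Proof.
move=> HX; exists C.
pose good r e := `|e| <= C * B r /\ Z r = (K * expR (G r + e))%:E.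
exists (fun r => xget 0 [set e | good r e]).
apply: filterS HX => r [X XC ZE].
suff /(xgetPex 0) : exists e, good r e by [].
exists (ln X); split; first exact: exp_close_ln.
by rewrite ZE expRD lnK ?mulrA// posrE (exp_close_gt0 XC).
Qed.

Lemma exp_close_avg (R : realType) (N : nat) (b : R) (X : nat -> R) : (0 < N)%N ->
  (forall m, exp_close b (X m)) ->
  exp_close b ((\sum_(1 <= m < N.+1) X m) / N%:R).
Proof.
move=> N0 XC; have NR : 0 < N%:R :> R by rewrite ltr0n.
have cst (x : R) : \sum_(1 <= m < N.+1) x = x * N%:R.
  by rewrite sumr_const_nat subn1 mulr_natr.
apply/andP; split; rewrite ?ler_pdivlMr ?ler_pdivrMr// -cst.
- by apply: ler_sum => m _; case/andP: (XC m).
- by apply: ler_sum => m _; case/andP: (XC m).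
Qed.

Theorem lemma2p12 (R : realType) (n : nat) (alpha beta : 'I_n -> R)
    (n_gt0 : (0 < n)%N) (alphaX : chamber alpha) (betaX : chamber beta) :
  (exists (C : R) (E : R -> R), \forall r \near +oo,
     `|E r| <= C * (expR (- r) + expR (- (2 * r / n%:R ^+ 2))) /\
     Zcro r alpha beta =
     (Zrad alpha * Zrad beta / (n%:R * Num.sqrt (pi / 2)) *
      expR (n%:R * (2 - n%:R) * r / 8 + ln r / 2 + E r))%:E) /\
  (forall N : nat, n = (2 * N)%N ->
   exists (C : R) (E : R -> R), \forall r \near +oo,
     `|E r| <= C * (expR (- r) + expR (- (2 * r / n%:R ^+ 2))) /\
     (\sum_(1 <= m < N.+1) Zcro r alpha (shift_angles (2 * m) beta))%E =
     (Zrad alpha * Zrad beta / Num.sqrt (2 * pi) *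
      expR (n%:R * (2 - n%:R) * r / 8 + ln r / 2 + E r))%:E).
Proof.
have [C HC] := Zcro_asymp R n_gt0; split.
  apply: (@exp_close_error _ C _ (fun r => expR (- r) + expR (- (2 * r / n%:R ^+ 2)))
    (fun r => n%:R * (2 - n%:R) * r / 8 + ln r / 2)).
  by apply: filterS HC => r; apply.
move=> N nN; have N0 : (0 < N)%N by move: n_gt0; rewrite nN; case: (N).
apply: (@exp_close_error _ C _ (fun r => expR (- r) + expR (- (2 * r / n%:R ^+ 2)))
  (fun r => n%:R * (2 - n%:R) * r / 8 + ln r / 2)).
apply: filterS HC => r HC.
have /choice[X HX] : forall m, exists X,
    exp_close (C * (expR (- r) + expR (- (2 * r / n%:R ^+ 2)))) X /\
    Zcro r alpha (shift_angles (2 * m) beta) =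
    (Zrad alpha * Zrad beta / (n%:R * Num.sqrt (pi / 2)) *
      expR (n%:R * (2 - n%:R) * r / 8 + ln r / 2) * X)%:E.
  move=> m; have [X XC XE] := HC alpha (shift_angles (2 * m) beta).
  by exists X; split; [exact: XC|rewrite XE Zrad_shift].
exists ((\sum_(1 <= m < N.+1) X m) / N%:R).
  by apply: exp_close_avg => // m; case: (HX m).
under eq_bigr => m _ do rewrite (HX m).2.
rewrite sumEFin -mulr_sumr; congr EFin.
have sqrt4 : Num.sqrt (2 * pi) = 2 * Num.sqrt (pi / 2) :> R.
  have -> : 2 * pi = 2 ^+ 2 * (pi / 2) :> R by move: (@pi R) => t; field.
  by rewrite sqrtrM ?sqr_ge0// sqrtr_sqr ger0_norm.
have NR : N%:R != 0 :> R by rewrite pnatr_eq0 -lt0n.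
have s0 : Num.sqrt (pi / 2) != 0 :> R.
  by rewrite gt_eqF// sqrtr_gt0 divr_gt0 ?pi_gt0.
have n2N : n%:R = 2 * N%:R :> R by rewrite nN natrM.
by rewrite sqrt4 {1}n2N; field; rewrite NR s0.
Qed.
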